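(* Let $\mathcal X$ be a positive space of dimension $n\ge 1$. Then there is a natural isomorphism $$\eta:\ \mathcal S\mathcal X(\mathbb R^t)\ \stackrel{\sim}{\longrightarrow}\ \partial\overline{\mathcal X^+}$$ between the spherical tropical space of $\mathcal X$ and the tropical boundary of $\mathcal X(\mathbb R_{>0})$. Here $\eta$ is the map sending the class of a nonzero tropical point $x\in\mathcal X(\mathbb R^t)$ to the point of $\mathbb P(\mathbb R^{\mathbf B})$ with homogeneous coordinates $(F^t(x))_{F\in\mathbf B}$.
   Context: A positive space $\mathcal X$ of dimension $n$ is a rational variety with a nonempty collection (positive atlas) of rational coordinate systems $(X_1,\dots,X_n)$ such that the transition functions between any two of them are subtraction-free rational functions, i.e. obtained from the coordinates by addition, multiplication and division. For a semifield $\mathbb F$, the set $\mathcal X(\mathbb F)$ of $\mathbb F$-points is obtained by taking a copy of $\mathbb F^n$ for each coordinate system and gluing these copies by the bijections given by the transition functions evaluated in $\mathbb F$. Thus each coordinate system identifies $\mathcal X(\mathbb F)$ with $\mathbb F^n$. We use $\mathbb F=\mathbb R_{>0}$ with the usual operations, and the tropical semifield $\mathbb F=\mathbb R^t$, which is $\mathbb R$ with multiplication $a\otimes b=a+b$ and addition $a\oplus b=\max(a,b)$. A positive rational function on $\mathcal X$ is a rational function which in some (hence any) positive coordinate system can be written as a ratio of two Laurent polynomials with positive integral coefficients. These form a semifield $\mathbb Q_+(\mathcal X)$. A function $F\in\mathbb Q_+(\mathcal X)$ takes positive values on $\mathcal X(\mathbb R_{>0})$, and it has a tropicalization $F^t:\mathcal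 X(\mathbb R^t)\to\mathbb R$, obtained by evaluating a subtraction-free expression for $F$ in $\mathbb R^t$. Spherical tropical space: $\lambda\in\mathbb R^*_{>0}$ acts on $\mathcal X(\mathbb R^t)$ by multiplying all coordinates in some (hence any) positive coordinate system by $\lambda$. $\mathcal S\mathcal X(\mathbb R^t)$ is the quotient of $\mathcal X(\mathbb R^t)\setminus\{0\}$ by this action, where $0$ is the point all of whose coordinates vanish; it is piecewise linearly isomorphic to $S^{n-1}$. Tropical compactification: choose a countable basis $\mathbf B$ of the multiplicative (semi)group $\mathbb Q_+(\mathcal X)$. The map $\mathcal X(\mathbb R_{>0})\to\mathbb R^{\mathbf B}$, $x\mapsto(\log F(x))_{F\in\mathbf B}$, composed with projectivisation gives an injective map $\tau:\mathcal X(\mathbb R_{>0})\hookrightarrow\mathbb P(\mathbb R^{\mathbf B})$, where $\mathbb P(\mathbb R^{\mathbf B})=(\mathbb R^{\mathbf B}\setminus\{0\})/\mathbb R^*$ has the quotient of the product topology. Put $\mathcal X^+=\tau(\mathcal X(\mathbb R_{>0}))$. The tropical compactification $\overline{\mathcal X^+}$ is the closure of $\mathcal X^+$ in $\mathbb P(\mathbb R^{\mathbf B})$, and the tropical boundary is $\partial\overline{\mathcal X^+}=\overline{\mathcal X^+}\setminus\mathcal X^+$. ''Isomorphism'' means homeomorphism (where $\mathcal S\mathcal X(\mathbb R^t)$ carries the quotient topology). *)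

(* Defs.v *)
From HB Require Import structures.
From Stdlib Require Import Relation_Operators.
From mathcomp Require Import all_boot all_order all_algebra.
From mathcomp Require Import generic_quotient.
From mathcomp Require Import all_classical all_reals.
From mathcomp Require Import interval_inference topology normedtype exp.
From mathcomp Require mpoly.

Set Implicit Arguments.
Unset Strict Implicit.
Unset Printing Implicit Defensive.

Import Order.TTheory GRing.Theory Num.Theory numFieldNormedType.Exports.

Local Open Scope classical_set_scope.
Local Open Scope ring_scope.
Local Open Scope quotient_scope.

(* Semifields have no zero element: (T, smul) is an abelian group. *)
Record semifield (T : Type) := Semifield {
  sadd : T -> T -> T;
  smul : T -> T -> T;
  sone : T;
  sinv : T -> T;
  saddA : associative sadd;
  saddC : commutative sadd;
  smulA : associative smul;
  smulC : commutative smul;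
  smul1 : left_id sone smul;
  smulV : left_inverse sone sinv smul;
  smulDl : left_distributive smul sadd }.

Definition sdiv (T : Type) (S : semifield T) (a b : T) : T :=
  smul S a (sinv S b).

Section PositiveReals.
Variable R : realType.

Definition posadd (x y : {posnum R}) : {posnum R} := (x%:num + y%:num)%:pos.
Definition posmul (x y : {posnum R}) : {posnum R} := (x%:num * y%:num)%:pos.
Definition posinv (x : {posnum R}) : {posnum R} := (x%:num^-1)%:pos.

Definition positive_reals : semifield {posnum R}.
Proof.
refine (@Semifield _ posadd posmul 1%:pos posinv _ _ _ _ _ _ _).
- by move=> x y z; apply: val_inj; rewrite /= addrA.
- by move=> x y; apply: val_inj; rewrite /= addrC.
- by move=> x y z; apply: val_inj; rewrite /= mulrA.
- by move=> x y; apply: val_inj; rewrite /= mulrC.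
- by move=> x; apply: val_inj; rewrite /= mul1r.
- by move=> x; apply: val_inj; rewrite /= mulVf.
- by move=> x y z; apply: val_inj; rewrite /= mulrDl.
Defined.

Definition tropical_reals : semifield R.
Proof.
refine (@Semifield R Num.max +%R 0 -%R _ _ _ _ _ _ _).
- exact: maxA.
- exact: maxC.
- exact: addrA.
- exact: addrC.
- exact: add0r.
- exact: addNr.
- exact: addr_maxl.
Defined.

End PositiveReals.

(* There are no constants: 1 is 'X_i / 'X_i as soon as n > 0. *)
Inductive sf_expr (n : nat) : Type :=
| SfVar of 'I_n
| SfAdd of sf_expr n & sf_expr n
| SfMul of sf_expr n & sf_expr n
| SfDiv of sf_expr n & sf_expr n.

Fixpoint sf_eval_with (n : nat) (T : Type) (add mul div : T -> T -> T)
    (x : 'I_n -> T) (e : sf_expr n) : T :=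
  let ev := sf_eval_with add mul div x in
  match e with
  | SfVar i => x i
  | SfAdd a b => add (ev a) (ev b)
  | SfMul a b => mul (ev a) (ev b)
  | SfDiv a b => div (ev a) (ev b)
  end.

Definition sf_eval (n : nat) (T : Type) (S : semifield T) :=
  @sf_eval_with n T (sadd S) (smul S) (@sdiv T S).

(* In characteristic 0, and at algebraically independent elements, no
   subtraction-free expression vanishes, so that no division by 0 occurs. *)
Definition sf_evalF (n : nat) (K : fieldType) :=
  @sf_eval_with n K +%R *%R (fun a b => a / b).

Section CoordinateSystem.
(* Local, and without the notations, which clash with those of topology. *)
Import -(notations) mpoly.

(* The datum of a birational isomorphism with the affine n-space: the x i are
   algebraically independent over k and generate K as a field over k. *)
Definition coordinate_system (n : nat) (k K : fieldType)
    (iota : {rmorphism k -> K}) (x : 'I_n -> K) : Prop :=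
  let ev (p : mpoly n k) : K := mmap iota x p in
  (forall p, ev p = 0 -> p = 0) /\
  (forall f, exists p q, ev q != 0 /\ f = ev p / ev q).

End CoordinateSystem.

(* Everything depends on the rational variety only up to birational
   equivalence; it is represented by its field of rational functions. *)
Record positive_space (k : fieldType) (n : nat) := PositiveSpace {
  ratfun : fieldType;
  ratfun_base : {rmorphism k -> ratfun};
  atlas : set ('I_n -> ratfun);
  atlas_nonempty : atlas !=set0;
  atlas_coordinates :
    forall x, atlas x -> coordinate_system ratfun_base x;
  atlas_positive :
    forall x y, atlas x -> atlas y ->
    forall i, exists e : sf_expr n, y i = sf_evalF x e }.

Arguments atlas {k n} p _.
Arguments ratfun_base {k n} p.


Section GeneratedEquivalence.
Variables (T : Type) (r : T -> T -> Prop).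

Definition gen_rel : rel T := fun x y => `[< clos_refl_sym_trans T r x y >].

Fact gen_rel_refl : reflexive gen_rel.
Proof. by move=> x; apply/asboolP; exact: rst_refl. Qed.

Fact gen_rel_sym : symmetric gen_rel.
Proof. by move=> x y; apply/asboolP/asboolP; exact: rst_sym. Qed.

Fact gen_rel_trans : transitive gen_rel.
Proof.
by move=> y x z /asboolP xy /asboolP yz; apply/asboolP; exact: rst_trans xy yz.
Qed.

Definition gen_equiv : equiv_rel T :=
  EquivRel gen_rel gen_rel_refl gen_rel_sym gen_rel_trans.

End GeneratedEquivalence.

Section Points.
Variables (k : fieldType) (n : nat) (X : positive_space k n).
Variables (T : choiceType) (S : semifield T).

Definition copies := {x : atlas X & 'rV[T]_n}.

Definition transition (u v : copies) : Prop :=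
  forall i : 'I_n, exists e : sf_expr n,
    val (tag v) i = sf_evalF (val (tag u)) e /\
    tagged v 0 i = sf_eval S (tagged u 0) e.

(* Two subtraction-free expressions of the same rational function have the same
   value in every semifield, so that generating an equivalence relation adds
   nothing to the bijections between copies. *)
Definition points := {eq_quot (gen_equiv transition)}.

HB.instance Definition _ := Quotient.on points.
HB.instance Definition _ := Choice.on points.

Definition point_of (x : atlas X) (p : 'rV[T]_n) : points :=
  \pi_points (existT (fun=> 'rV[T]_n) x p).

(* The value of F at a point; the default value is irrelevant, since the
   set is a singleton when F is a positive rational function. *)
Definition value (F : ratfun X) (a : points) : T :=
  xget (sone S) [set t | exists (x : atlas X) (p : 'rV[T]_n) (e : sf_expr n),
    [/\ a = point_of x p, F = sf_evalF (val x) e & t = sf_eval S (p 0) e]].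

End Points.

Section PositiveFunctions.
Variables (k : fieldType) (n : nat) (X : positive_space k n).
Local Notation K := (ratfun X).

(* The Laurent polynomials in x with positive integral coefficients, given by
   a nonempty list of pairs (exponent, coefficient). *)
Definition positive_laurent (x : 'I_n -> K) : set K :=
  [set f | exists s : seq ({ffun 'I_n -> int} * nat),
    [/\ s != [::], all (fun t => 0 < t.2)%N s &
        f = \sum_(t <- s) (\prod_(i < n) x i ^ t.1 i) *+ t.2]].

Definition positive_functions : set K :=
  [set F | exists x P Q, [/\ atlas X x, positive_laurent x P,
                             positive_laurent x Q & F = P / Q]].

(* A basis of (positive_functions, * ) as an abelian group. *)
Definition multiplicative_basis (B : set K) : Prop :=
  [/\ B `<=` positive_functions,
      forall F, positive_functions F ->
        exists (s : seq K) (m : K -> int),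
          [set` s] `<=` B /\ F = \prod_(b <- s) b ^ m b
    & forall (s : seq K) (m : K -> int),
        uniq s -> [set` s] `<=` B -> \prod_(b <- s) b ^ m b = 1 ->
        {in s, forall b, m b = 0}].

End PositiveFunctions.

Section SphericalTropicalSpace.
Variables (k : fieldType) (n : nat) (X : positive_space k n) (R : realType).
Local Notation Rt := (tropical_reals R).

(* The topology glued from those of the copies of R^n. *)
Definition tropical_points := quotient_topology (points X Rt).

HB.instance Definition _ := Topological.on tropical_points.
HB.instance Definition _ := Quotient.on tropical_points.

Definition tropical_point_of (x : atlas X) (p : 'rV[R]_n) : tropical_points :=
  point_of Rt x p.

Definition tropical_zero : set tropical_points :=
  [set a | exists x, a = tropical_point_of x 0].

Definition nonzero_tropical_points : Type := ~` tropical_zero.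

HB.instance Definition _ := Topological.on nonzero_tropical_points.

Definition scaling (a b : tropical_points) : Prop :=
  exists (l : R) (x : atlas X) (p : 'rV[R]_n),
    [/\ 0 < l, a = tropical_point_of x p & b = tropical_point_of x (l *: p)].

Lemma sf_eval_scale (l : R) (p : 'rV[R]_n) (e : sf_expr n) : 0 < l ->
  sf_eval Rt ((l *: p) 0) e = l * sf_eval Rt (p 0) e.
Proof.
move=> l0; rewrite /sf_eval.
elim: e => [i|a IHa b IHb|a IHa b IHb|a IHa b IHb] /=.
- by rewrite mxE.
- by rewrite IHa IHb maxr_pMr // ltW.
- by rewrite IHa IHb mulrDr.
- by rewrite IHa IHb /sdiv /= mulrBr.
Qed.

Lemma tropical_point_of_eq (x y : atlas X) (p q : 'rV[R]_n) :
  tropical_point_of x p = tropical_point_of y q <->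
  clos_refl_sym_trans (copies X R) (transition Rt) (existT _ x p) (existT _ y q).
Proof.
split=> [/eqmodP/asboolP //|H]; apply/eqmodP; exact/asboolP.
Qed.

Lemma tropical_point_of_scale (x y : atlas X) (p q : 'rV[R]_n) (l : R) : 0 < l ->
  tropical_point_of x p = tropical_point_of y q ->
  tropical_point_of x (l *: p) = tropical_point_of y (l *: q).
Proof.
move=> l0 /tropical_point_of_eq H; apply/tropical_point_of_eq.
pose sc (u : copies X R) : copies X R := existT _ (tag u) (l *: tagged u).
rewrite -[existT _ x _]/(sc (existT _ x p)) -[existT _ y _]/(sc (existT _ y q)).
elim: H => [u v uv|u|u v _|u v w _ uv _].
- apply: rst_step => i; have [e [E1 E2]] := uv i; exists e; split=> //=.
  by rewrite sf_eval_scale // mxE E2.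
- exact: rst_refl.
- exact: rst_sym.
- exact: rst_trans.
Qed.

Lemma tropical_pointP (a : tropical_points) :
  exists x p, a = tropical_point_of x p.
Proof.
exists (tag (repr a)), (tagged (repr a)).
by rewrite /tropical_point_of /point_of; case: (repr a) (reprK a) => x p /= <-.
Qed.

Definition scaling_rel : rel nonzero_tropical_points :=
  fun a b => `[< scaling (val a) (val b) >].

Fact scaling_refl : reflexive scaling_rel.
Proof.
move=> a; apply/asboolP; have [x [p ap]] := tropical_pointP (val a).
by exists 1, x, p; rewrite scale1r; split.
Qed.

Fact scaling_sym : symmetric scaling_rel.
Proof.
suff H a b : scaling_rel a b -> scaling_rel b a by move=> a b; apply/idP/idP; exact: H.
move=> /asboolP[l [x [p [l0 ap bp]]]]; apply/asboolP.
exists l^-1, x, (l *: p); rewrite invr_gt0 scalerA mulVf ?scale1r ?gt_eqF //.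
Qed.

Fact scaling_trans : transitive scaling_rel.
Proof.
move=> b a c /asboolP[l [x [p [l0 ap bp]]]] /asboolP[m [y [q [m0 bq cq]]]].
apply/asboolP; exists (m * l), x, p; split; rewrite ?mulr_gt0 //.
by rewrite cq -scalerA; apply: tropical_point_of_scale; rewrite // -bq.
Qed.

Definition scaling_equiv : equiv_rel nonzero_tropical_points :=
  EquivRel scaling_rel scaling_refl scaling_sym scaling_trans.

Definition spherical_space := quotient_topology {eq_quot scaling_equiv}.

HB.instance Definition _ := Topological.on spherical_space.
HB.instance Definition _ := Quotient.on spherical_space.

End SphericalTropicalSpace.

(* P(R^I) = (R^I \ {0}) / R^*, with negative scalars allowed. *)
Section ProjectiveSpace.
Variables (R : realType) (I : Type).

Definition nonzero_vectors : Type := [set v : {ptws I -> R} | exists i, v i != 0].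

HB.instance Definition _ := Topological.on nonzero_vectors.

Definition proportional : rel nonzero_vectors :=
  fun v w => `[< exists2 c : R, c != 0 & forall i, val w i = c * val v i >].

Fact proportional_refl : reflexive proportional.
Proof. by move=> v; apply/asboolP; exists 1 => [|i]; rewrite ?oner_neq0 ?mul1r. Qed.

Fact proportional_sym : symmetric proportional.
Proof.
suff H v w : proportional v w -> proportional w v
  by move=> v w; apply/idP/idP; exact: H.
move=> /asboolP[c c0 vw]; apply/asboolP; exists c^-1; first by rewrite invr_eq0.
by move=> i; rewrite vw mulKf.
Qed.

Fact proportional_trans : transitive proportional.
Proof.
move=> w v z /asboolP[c c0 vw] /asboolP[d d0 wz]; apply/asboolP.
by exists (d * c) => [|i]; rewrite ?mulf_neq0 // wz vw mulrA.
Qed.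

Definition proportional_equiv : equiv_rel nonzero_vectors :=
  EquivRel proportional proportional_refl proportional_sym proportional_trans.

Definition projective_space := quotient_topology {eq_quot proportional_equiv}.

HB.instance Definition _ := Topological.on projective_space.
HB.instance Definition _ := Quotient.on projective_space.

(* P has homogeneous coordinates v; in particular v != 0. *)
Definition homogeneous_coordinates (P : projective_space) (v : I -> R) : Prop :=
  exists2 w : nonzero_vectors, val w = v & P = \pi_projective_space w.

End ProjectiveSpace.

Section TropicalCompactification.
Variables (k : fieldType) (n : nat) (X : positive_space k n) (R : realType).
Variable B : set (ratfun X).

Definition log_coordinates (a : points X (positive_reals R)) (F : B) : R :=
  ln (value (val F) a)%:num.

Definition tropical_coordinates (a : tropical_points X R) (F : B) : R :=
  value (val F) (a : points X (tropical_reals R)).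

Definition positive_part : set (projective_space R B) :=
  [set P | exists a, homogeneous_coordinates P (log_coordinates a)].

Definition tropical_boundary : set (projective_space R B) :=
  closure positive_part `\` positive_part.

End TropicalCompactification.

Arguments positive_part {k n X} R B _.
Arguments tropical_boundary {k n X} R B _.

Definition homeomorphism (T U : topologicalType) (f : T -> U) : Prop :=
  continuous f /\
  exists g : U -> T, [/\ continuous g, cancel f g & cancel g f].

(* Main.v *)
From HB Require Import structures.
Require Import Defs.
From Stdlib Require Import Relation_Operators.
From mathcomp Require Import all_boot all_order all_algebra.
From mathcomp Require Import generic_quotient.
From mathcomp Require Import all_classical all_reals.
From mathcomp Require Import interval_inference topology normedtype sequences exp.
From mathcomp Require mpoly.
From mathcomp Require Import ring lra.

(** Fix a positive chart, with coordinates X_i.  A positive function is then given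
by a subtraction-free expression, and its values in a semifield depend on the
function only, not on the expression ([sf_eval_unique]): clearing denominators,
an equality of two expressions at algebraically independent elements in
characteristic 0 is an equality of two multisets of monomials, because positive
sums do not cancel, and such an equality can be evaluated in any semifield.
Hence the chart identifies the points over every semifield with vectors, and
the value of a positive function at a point makes sense ([value_point_of]).

Expanding a positive function F in the basis B gives, for every u in R^B, a
number u(F), linear and continuous in u ([basis_form]); it is log F(x) when u is
the vector of logarithms of a positive point x, and F^t(x) when u is the vector
of a tropical point x.  Let C be the cone of all u = c log(x) with c <> 0.  Since
the projection from R^B \ {0} is open, the closure of X^+ is the image of the
closure of C ([closure_positive_part]), and every closed relation valid on C
remains valid on its closure.  The coordinate u(2) = c log 2 separates two cases
for a point v of the closure of C.

If v(2) <> 0, rescale so that v(2) = log 2.  The relations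
exp u(F + G) = exp u(F) + exp u(G) pass to the limit, so v is the logarithm of
the positive point with coordinates exp v(X_i), and v belongs to C
([closure_log_cone_two]).

If v(2) = 0, one uses that | log(a + b) - max(log a, log b) | <= log 2.  The
constant c may have either sign; to remove this ambiguity, multiply by a
positive function: let N = 2 + sum_i (X_i + 1/X_i), whose logarithm is
positive and bounds |log X_i|.  The vector w = u(N) u is a nonnegative multiple of
log(x), so that | w(F + G) - max(w(F), w(G)) | <= w(2) on C.  At v the right-hand
side vanishes: v(N) v is the vector of the tropical point with
coordinates v(N) v(X_i) ([closure_tropical_eval]), and v(N) <> 0 since
|u(F)| <= K_F |u(N)| on C ([closure_gauge_neq0]).  Conversely the vector of a
nonzero tropical point q is the limit of log(exp(m q)) / m, and it is not in C
since 2^t = 0 ([tropical_boundaryP]).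

So eta is bijective, with inverse [v] |-> the ray of (v(N) v(X_i))_i, which
is a formula invariant under v |-> c v up to the positive factor c^2.  This
formula is continuous in v, and the openness of the projection makes the
inverse continuous ([eta_inv_continuous]). *)

Set Implicit Arguments.
Unset Strict Implicit.
Unset Printing Implicit Defensive.

Import Order.TTheory GRing.Theory Num.Theory numFieldNormedType.Exports.

Local Open Scope classical_set_scope.
Local Open Scope ring_scope.
Local Open Scope quotient_scope.

(** * Positive polynomials in a semifield *)

(** Adjoining a zero to a semifield gives a commutative semiring, in which the
library's sums, possibly empty, make sense. *)
Definition with_zero (T : Type) (S : semifield T) : Type := option T.

Section WithZero.
Variables (T : choiceType) (S : semifield T).
Local Notation A := (with_zero S).

HB.instance Definition _ := Choice.copy A (option T).

Definition wz_add (a b : A) : A :=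
  match a, b with
  | Some x, Some y => Some (sadd S x y)
  | None, c | c, None => c
  end.

Definition wz_mul (a b : A) : A :=
  if a is Some x then if b is Some y then Some (smul S x y) else None else None.

Fact wz_addA : associative wz_add.
Proof. by move=> [x|] [y|] [z|] //=; rewrite saddA. Qed.
Fact wz_addC : commutative wz_add.
Proof. by move=> [x|] [y|] //=; rewrite saddC. Qed.
Fact wz_add0 : left_id (None : A) wz_add. Proof. by case. Qed.

HB.instance Definition _ :=
  GRing.isNmodule.Build A wz_addA wz_addC wz_add0.

Fact wz_mulA : associative wz_mul.
Proof. by move=> [x|] [y|] [z|] //=; rewrite smulA. Qed.
Fact wz_mulC : commutative wz_mul.
Proof. by move=> [x|] [y|] //=; rewrite smulC. Qed.
Fact wz_mul1 : left_id (Some (sone S) : A) wz_mul.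
Proof. by move=> [x|] //=; rewrite smul1. Qed.
Fact wz_mulDl : left_distributive wz_mul wz_add.
Proof. by move=> [x|] [y|] [z|] //=; rewrite smulDl. Qed.
Fact wz_mul0 : left_zero (None : A) wz_mul. Proof. by []. Qed.

HB.instance Definition _ :=
  GRing.Nmodule_isComPzSemiRing.Build A wz_mulA wz_mulC wz_mul1 wz_mulDl wz_mul0.

Definition finite_part (a : T) : A := Some a.

Lemma finite_partD a b :
  finite_part (sadd S a b) = finite_part a + finite_part b. Proof. by []. Qed.
Lemma finite_partM a b :
  finite_part (smul S a b) = finite_part a * finite_part b. Proof. by []. Qed.
Lemma finite_part1 : finite_part (sone S) = 1. Proof. by []. Qed.

Lemma finite_part_inj : injective finite_part. Proof. by move=> a b []. Qed.

(** Two expressions are compared after clearing denominators; this allows the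
denominators to be cancelled again. *)
Lemma finite_part_mulI a : injective ( *%R (finite_part a)).
Proof.
move=> u v uv; rewrite -[u]mul1r -[v]mul1r -finite_part1 -(smulV S a).
by rewrite finite_partM -!mulrA uv.
Qed.

Lemma with_zeroP (a : A) : a != 0 -> exists b, a = finite_part b.
Proof. by case: a => // b _; exists b. Qed.

End WithZero.

Section PositivePolynomials.
Variable n : nat.

(** A positive polynomial is encoded by the list of its monomials, repeated
according to their coefficients, so that the same data can be evaluated in a
field and in a semiring without subtraction. *)
Definition monomials := seq {ffun 'I_n -> nat}.

Definition monomials_mul (s t : monomials) : monomials :=
  [seq [ffun i => (a i + b i)%N] : {ffun 'I_n -> nat}
  | a : {ffun 'I_n -> nat} <- s, b : {ffun 'I_n -> nat} <- t].

Definition monomials_eval (A : comPzSemiRingType) (x : 'I_n -> A) (s : monomials) : A :=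
  \sum_(a <- (s : seq {ffun 'I_n -> nat})) \prod_(i < n) x i ^+ a i.

Lemma monomials_eval_cat (A : comPzSemiRingType) (x : 'I_n -> A) s t :
  monomials_eval x (s ++ t) = monomials_eval x s + monomials_eval x t.
Proof. by rewrite /monomials_eval big_cat. Qed.

Lemma monomials_eval_mul (A : comPzSemiRingType) (x : 'I_n -> A) s t :
  monomials_eval x (monomials_mul s t) = monomials_eval x s * monomials_eval x t.
Proof.
rewrite /monomials_eval /monomials_mul big_allpairs_dep big_distrlr /=.
apply: eq_bigr => a _; apply: eq_bigr => b _; rewrite -big_split /=.
by apply: eq_bigr => i _; rewrite ffunE exprD.
Qed.

Lemma monomials_eval_perm (A : comPzSemiRingType) (x : 'I_n -> A) s t :
  perm_eq s t -> monomials_eval x s = monomials_eval x t.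
Proof. by move=> st; rewrite /monomials_eval (perm_big _ st). Qed.

Lemma monomials_mul_eq0 s t :
  (monomials_mul s t == [::]) = (s == [::]) || (t == [::]).
Proof. by rewrite -!size_eq0 size_allpairs muln_eq0. Qed.

(** Every expression is a quotient of two positive polynomials; these are formed
by the rules for adding and multiplying fractions, with no simplification, so
that they do not depend on where the expression is evaluated. *)
Fixpoint num_den (e : sf_expr n) : monomials * monomials :=
  match e with
  | SfVar j => ([:: [ffun i => (i == j : nat)]], [:: [ffun=> 0%N]])
  | SfAdd a b =>
      let: (p, q) := num_den a in let: (r, s) := num_den b in
      (monomials_mul p s ++ monomials_mul r q, monomials_mul q s)
  | SfMul a b =>
      let: (p, q) := num_den a in let: (r, s) := num_den b in
      (monomials_mul p r, monomials_mul q s)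
  | SfDiv a b =>
      let: (p, q) := num_den a in let: (r, s) := num_den b in
      (monomials_mul p s, monomials_mul q r)
  end.
Notation num e := (num_den e).1.
Notation den e := (num_den e).2.

Lemma num_den_neq0 e : (num e != [::]) && (den e != [::]).
Proof.
elim: e => [j|a IHa b IHb|a IHa b IHb|a IHa b IHb] //=;
  case: (num_den a) IHa => p q /= /andP[p0 q0];
  case: (num_den b) IHb => r s /= /andP[r0 s0];
  rewrite ?monomials_mul_eq0 ?negb_or ?p0 ?q0 ?r0 ?s0 //= andbT.
by rewrite -size_eq0 size_cat addn_eq0 !size_eq0 monomials_mul_eq0 negb_and
  (negbTE p0) (negbTE s0).
Qed.

Lemma monomials_eval_var (A : comPzSemiRingType) (x : 'I_n -> A) j :
  monomials_eval x [:: [ffun i => (i == j : nat)]] = x j.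
Proof.
rewrite /monomials_eval big_seq1 (bigD1 j) //= ffunE eqxx big1 ?mulr1 // => i ij.
by rewrite ffunE (negbTE ij).
Qed.

Lemma monomials_eval_one (A : comPzSemiRingType) (x : 'I_n -> A) :
  monomials_eval x [:: [ffun=> 0%N]] = 1.
Proof. by rewrite /monomials_eval big_seq1 big1 // => i _; rewrite ffunE. Qed.

Section SemifieldEval.
Variables (T : choiceType) (S : semifield T) (p : 'I_n -> T).
Let y : 'I_n -> with_zero S := @finite_part T S \o p.

(** A semifield has no zero: a nonempty sum of products of its elements is
again one of its elements. *)
Lemma monomials_eval_finite s : s != [::] -> monomials_eval y s != 0.
Proof.
have H a : exists b, \prod_(i < n) y i ^+ a i = finite_part S b.
  apply: (big_ind (fun z => exists b, z = finite_part S b)).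
  - by exists (sone S).
  - by move=> _ _ [b ->] [c ->]; exists (smul S b c).
  - move=> i _; elim: (a i) => [|k [b IH]]; first by exists (sone S).
    by exists (smul S (p i) b); rewrite exprS IH.
case: s => // a s _; rewrite /monomials_eval big_cons; have [b ->] := H a.
by case: (\sum_(_ <- _) _).
Qed.

Lemma monomials_eval_sf_eval e :
  finite_part S (sf_eval S p e) * monomials_eval y (den e) = monomials_eval y (num e).
Proof.
elim: e => [j|a IHa b IHb|a IHa b IHb|a IHa b IHb] /=.
- by rewrite monomials_eval_var monomials_eval_one mulr1.
- case: (num_den a) IHa => p1 q /= IHa; case: (num_den b) IHb => r s /= IHb.
  rewrite finite_partD monomials_eval_cat !monomials_eval_mul -IHa -IHb mulrDl; congr (_ + _).
    by rewrite mulrA.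
  by rewrite [monomials_eval y q * _]mulrC mulrA.
- case: (num_den a) IHa => p1 q /= IHa; case: (num_den b) IHb => r s /= IHb.
  by rewrite finite_partM !monomials_eval_mul -IHa -IHb mulrACA.
- case: (num_den a) IHa => p1 q /= IHa; case: (num_den b) IHb => r s /= IHb.
  rewrite finite_partM !monomials_eval_mul -IHa -IHb.
  by rewrite mulrACA [X in _ * X]mulrA -finite_partM smulV finite_part1 mul1r.
Qed.

End SemifieldEval.

Section FieldEval.
Import -(notations) mpoly.
Variables (k K : fieldType) (iota : {rmorphism k -> K}) (x : 'I_n -> K).
Hypotheses (k0 : [pchar k] =i pred0) (xP : coordinate_system iota x).

Let poly_of (s : monomials) : mpoly n k :=
  \sum_(a <- s) mpolyX k (Multinom [tuple a i | i < n]).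

Lemma mmap_poly_of s : mmap iota x (poly_of s) = monomials_eval x s.
Proof.
rewrite /poly_of raddf_sum; apply: eq_bigr => a _; rewrite /= mmapX /mmap1.
by apply: eq_bigr => i _; rewrite /fun_of_multinom tnth_mktuple.
Qed.

Lemma mcoeff_poly_of s (a : {ffun 'I_n -> nat}) :
  mcoeff (Multinom [tuple a i | i < n]) (poly_of s) = (count_mem a s)%:R.
Proof.
rewrite /poly_of raddf_sum -sum1_count natr_sum [RHS]big_mkcond /=.
apply: eq_bigr => b _; rewrite mcoeffX; case: (eqVneq b a) => [->|ba]; first by rewrite !eqxx.
case: eqP => // E; case/eqP: ba; apply/ffunP => i.
by have := congr1 (fun m => fun_of_multinom m i) E; rewrite /fun_of_multinom !tnth_mktuple.
Qed.

(** At algebraically independent elements over a field of characteristic 0, the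
value of a positive polynomial determines the multiplicity of every monomial,
which is its coefficient. *)
Lemma monomials_eval_inj s t : monomials_eval x s = monomials_eval x t -> perm_eq s t.
Proof.
move=> st; apply/allP => a _; rewrite /=.
(* Both lists are sums of monomials in the polynomial ring, where they agree. *)
have /eqP : poly_of s - poly_of t = 0.
  by apply: xP.1; rewrite raddfB /= !mmap_poly_of st subrr.
rewrite subr_eq0 => /eqP/(congr1 (mcoeff (Multinom [tuple a i | i < n]))).
rewrite !mcoeff_poly_of => /eqP; move/pcharf0P: k0 => char0.
wlog le : s t st / (count_mem a s <= count_mem a t)%N => [W|].
  case: (leqP (count_mem a s) (count_mem a t)) => [|/ltnW] le; first exact: W.
  by rewrite eq_sym => /W; rewrite eq_sym; apply.
by rewrite eq_sym -subr_eq0 -natrB // char0 subn_eq0 eqn_leq le.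
Qed.

Lemma monomials_eval_neq0 s : s != [::] -> monomials_eval x s != 0.
Proof.
move=> s0; apply/eqP => E; case/eqP: s0; apply: perm_small_eq => //.
by apply: monomials_eval_inj; rewrite E /monomials_eval big_nil.
Qed.

Lemma sf_evalF_frac e : sf_evalF x e = monomials_eval x (num e) / monomials_eval x (den e).
Proof.
elim: e => [j|a IHa b IHb|a IHa b IHb|a IHa b IHb] /=.
- by rewrite monomials_eval_var monomials_eval_one divr1.
all: rewrite /sf_evalF /= -!/(sf_evalF x _) IHa IHb;
  have /andP[/monomials_eval_neq0 + /monomials_eval_neq0] := num_den_neq0 a;
  have /andP[/monomials_eval_neq0 + /monomials_eval_neq0] := num_den_neq0 b;
  case: (num_den a) => p q; case: (num_den b) => r s /= r0 s0 p0 q0;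
  rewrite ?monomials_eval_cat !monomials_eval_mul; field; by rewrite ?r0 ?s0 ?p0 ?q0.
Qed.

Lemma sf_evalF_neq0 e : sf_evalF x e != 0.
Proof.
rewrite sf_evalF_frac.
have /andP[/monomials_eval_neq0 a /monomials_eval_neq0 b] := num_den_neq0 e.
by rewrite mulf_neq0 ?invr_eq0.
Qed.

(** The denominators being nonzero in the field, the hypothesis is an identity
num e * den f = num f * den e of lists of monomials up to permutation, which
can be evaluated in the semifield. *)
Lemma sf_eval_unique (T : choiceType) (S : semifield T) (p : 'I_n -> T) e f :
  sf_evalF x e = sf_evalF x f -> sf_eval S p e = sf_eval S p f.
Proof.
rewrite !sf_evalF_frac.
have /andP[_ e0] := num_den_neq0 e; have /andP[_ f0] := num_den_neq0 f.
move=> /eqP; rewrite eqr_div ?monomials_eval_neq0 // -!monomials_eval_mul.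
move=> /eqP /monomials_eval_inj E.
have := monomials_eval_perm (@finite_part T S \o p) E.
rewrite !monomials_eval_mul -!monomials_eval_sf_eval.
have [d Ed] := with_zeroP (monomials_eval_finite S p e0).
have [d' Ed'] := with_zeroP (monomials_eval_finite S p f0).
rewrite Ed Ed' => H; apply: (@finite_part_inj T S).
apply: (@finite_part_mulI _ _ d); apply: (@finite_part_mulI _ _ d').
by rewrite [X in _ * X = _]mulrC [LHS]mulrC H [RHS]mulrA [RHS]mulrC mulrA.
Qed.

End FieldEval.

End PositivePolynomials.

(** * Subtraction-free expressions and values at points *)

Section Expressions.
Variable n : nat.

Fixpoint sf_subst (f : 'I_n -> sf_expr n) (e : sf_expr n) : sf_expr n :=
  match e with
  | SfVar i => f i
  | SfAdd a b => SfAdd (sf_subst f a) (sf_subst f b)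
  | SfMul a b => SfMul (sf_subst f a) (sf_subst f b)
  | SfDiv a b => SfDiv (sf_subst f a) (sf_subst f b)
  end.

Lemma sf_eval_with_subst (T : Type) (add mul div : T -> T -> T) x y f e :
  (forall i, y i = sf_eval_with add mul div x (f i)) ->
  sf_eval_with add mul div x (sf_subst f e) = sf_eval_with add mul div y e.
Proof.
move=> yE.
elim: e => [i|a IHa b IHb|a IHa b IHb|a IHa b IHb] //=; by rewrite IHa IHb.
Qed.

Variable i0 : 'I_n.

Definition sf_one : sf_expr n := SfDiv (SfVar i0) (SfVar i0).

Definition sf_two : sf_expr n := SfAdd sf_one sf_one.

Definition sf_expz (e : sf_expr n) (z : int) : sf_expr n :=
  match z with
  | Posz k => iter k (SfMul e) sf_one
  | Negz k => SfDiv sf_one (iter k.+1 (SfMul e) sf_one)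
  end.

Definition sf_prod (s : seq (sf_expr n)) : sf_expr n :=
  foldr (@SfMul n) sf_one s.

Section InField.
Variables (K : fieldType) (x : 'I_n -> K).
Hypothesis xi0 : x i0 != 0.

Lemma sf_evalF_one : sf_evalF x sf_one = 1.
Proof. by rewrite /sf_evalF /= divff. Qed.

Lemma sf_evalF_expz e z : sf_evalF x (sf_expz e z) = sf_evalF x e ^ z.
Proof.
have H m : sf_evalF x (iter m (SfMul e) sf_one) = sf_evalF x e ^+ m.
  by elim: m => [|m IH]; rewrite ?sf_evalF_one // exprS -IH.
have D a b : sf_evalF x (SfDiv a b) = sf_evalF x a / sf_evalF x b by [].
by case: z => m; rewrite /sf_expz; [exact: H|rewrite D (H m.+1) sf_evalF_one div1r].
Qed.

Lemma sf_evalF_prod s : sf_evalF x (sf_prod s) = \prod_(e <- s) sf_evalF x e.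
Proof.
elim: s => [|e s IH]; first by rewrite big_nil sf_evalF_one.
by rewrite big_cons -IH.
Qed.

End InField.

(** The homomorphisms from the multiplicative group of a semifield to an additive
group: the logarithm on positive reals, the identity on tropical reals. *)
Definition log_like (T : Type) (S : semifield T) (V : zmodType) (phi : T -> V) :=
  forall a b, phi (smul S a b) = phi a + phi b.

Section InSemifield.
Variables (T : Type) (S : semifield T) (V : zmodType) (phi : T -> V).
Hypothesis phiM : log_like S phi.

Lemma log_like1 : phi (sone S) = 0.
Proof.
by have := phiM (sone S) (sone S); rewrite smul1 => /eqP; rewrite -subr_eq subrr => /eqP.
Qed.

Lemma log_like_div a b : phi (sdiv S a b) = phi a - phi b.
Proof.
rewrite /sdiv phiM; congr (_ + _); apply/eqP; rewrite -addr_eq0 -phiM smulV.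
by rewrite log_like1.
Qed.

Variable p : 'I_n -> T.

Lemma log_like_one : phi (sf_eval S p sf_one) = 0.
Proof. by rewrite /sf_eval /= log_like_div subrr. Qed.

Lemma log_like_expz e z : phi (sf_eval S p (sf_expz e z)) = phi (sf_eval S p e) *~ z.
Proof.
have H m : phi (sf_eval S p (iter m (SfMul e) sf_one)) = phi (sf_eval S p e) *+ m.
  by elim: m => [|m IH]; rewrite ?log_like_one // mulrS -IH -phiM.
have D a b : sf_eval S p (SfDiv a b) = sdiv S (sf_eval S p a) (sf_eval S p b).
  by [].
case: z => m; rewrite /sf_expz; first exact: H.
by rewrite D log_like_div (H m.+1) log_like_one sub0r.
Qed.

Lemma log_like_prod s :
  phi (sf_eval S p (sf_prod s)) = \sum_(e <- s) phi (sf_eval S p e).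
Proof.
elim: s => [|e s IH]; first by rewrite big_nil log_like_one.
by rewrite big_cons -IH -phiM.
Qed.

End InSemifield.

End Expressions.

Section Charts.
Variables (k : fieldType) (n : nat) (X : positive_space k n).
Hypothesis k0 : [pchar k] =i pred0.

Lemma chart_coordinates (x : atlas X) : coordinate_system (ratfun_base X) (val x).
Proof. exact: (atlas_coordinates (set_valP x)). Qed.

Lemma chart_change (x y : atlas X) :
  exists f : 'I_n -> sf_expr n, forall i, val y i = sf_evalF (val x) (f i).
Proof.
have [f fP] := choice (atlas_positive (set_valP x) (set_valP y)).
by exists f.
Qed.

Lemma sf_evalF_chart_change (x y : atlas X) e :
  exists f, sf_evalF (val y) e = sf_evalF (val x) f.
Proof.
have [f fP] := chart_change x y; exists (sf_subst f e).
by rewrite /sf_evalF (sf_eval_with_subst _ fP).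
Qed.

Section Values.
Variables (T : choiceType) (S : semifield T).

(** The invariant of the gluing: two points of copies represent the same point
when they give the same value to every function written in both charts. *)
Definition same_values (u v : copies X T) : Prop :=
  forall e f, sf_evalF (val (tag u)) e = sf_evalF (val (tag v)) f ->
    sf_eval S (tagged u 0) e = sf_eval S (tagged v 0) f.

(** Substituting the transition functions turns an expression in the second chart
into one in the first, where values are unique. *)
Lemma transition_same_values u v : transition S u v -> same_values u v.
Proof.
move=> /choice[f fP] e g.
rewrite /sf_evalF -(sf_eval_with_subst _ (fun i => (fP i).1)) => E.
rewrite {2}/sf_eval -(sf_eval_with_subst _ (fun i => (fP i).2)).
exact: (sf_eval_unique k0 (chart_coordinates (tag u)) S (tagged u 0) E).
Qed.

(** Transitivity of the invariant needs every function to be written in the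
intermediate chart, which the positivity of the atlas allows. *)
Lemma point_of_same_values x y p q :
  point_of S x p = point_of S y q ->
  same_values (existT (fun=> 'rV[T]_n) x p) (existT _ y q).
Proof.
move=> /eqmodP/asboolP H.
elim: H => [u v|u|u v _ uv|u v w _ uv _ vw].
- exact: transition_same_values.
- by move=> e f; exact: (sf_eval_unique k0 (chart_coordinates _)).
- by move=> e f E; apply/esym/uv.
- move=> e f; have [g E] := sf_evalF_chart_change (tag v) (tag u) e.
  move=> E'; rewrite (uv _ _ E); apply: vw; by rewrite -E.
Qed.

Lemma point_in_chart x (a : points X S) : exists p, a = point_of S x p.
Proof.
have [y [q ->]] : exists y q, a = point_of S y q.
  exists (tag (repr a)), (tagged (repr a)).
  by rewrite /point_of; case: (repr a) (reprK a) => y q /= <-.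
have [f fP] := chart_change y x.
exists (\row_i sf_eval S (q 0) (f i)).
apply/eqmodP/asboolP; apply: rst_step => i; exists (f i); split; first exact: fP.
by rewrite /= mxE.
Qed.

Lemma value_point_of (F : ratfun X) x p e :
  F = sf_evalF (val x) e -> value F (point_of S x p) = sf_eval S (p 0) e.
Proof.
move=> FE; apply: xget_unique => [|t [y [q [f [/point_of_same_values pq Ff ->]]]]].
  by exists x, p, e.
by apply/esym/pq; rewrite -FE -Ff.
Qed.

End Values.

Section PositiveFunctions.
Variable i0 : 'I_n.

Lemma chart_neq0 (x : atlas X) i : val x i != 0.
Proof. exact: (sf_evalF_neq0 k0 (chart_coordinates x) (SfVar i)). Qed.

Lemma sf_evalF_positive (x : atlas X) e : positive_functions (X := X) (sf_evalF (val x) e).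
Proof.
have := sf_evalF_frac k0 (chart_coordinates x) e; move=> ->.
have H (s : monomials n) : s != [::] -> positive_laurent (val x) (monomials_eval (val x) s).
  move=> s0; exists [seq ([ffun i => (a i)%:Z], 1%N) | a : {ffun 'I_n -> nat} <- s].
  split; first by case: s s0.
    by apply/allP => t /mapP[a _ ->].
  rewrite big_map; apply: eq_bigr => a _; rewrite mulr1n.
  by apply: eq_bigr => i _; rewrite ffunE.
have /andP[/H ? /H ?] := num_den_neq0 e.
exists (val x), (monomials_eval (val x) (num_den e).1), (monomials_eval (val x) (num_den e).2).
by split=> //; exact: set_valP.
Qed.

Lemma positive_laurent_sf (x : atlas X) P :
  positive_laurent (X := X) (val x) P -> exists e, P = sf_evalF (val x) e.
Proof.
have x0 := chart_neq0 x i0.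
case=> [s [s0 sP ->]].
have H (a : {ffun 'I_n -> int}) m : (0 < m)%N ->
    exists e, (\prod_(i < n) val x i ^ a i) *+ m = sf_evalF (val x) e.
  have [e eE] : exists e, \prod_(i < n) val x i ^ a i = sf_evalF (val x) e.
    exists (sf_prod i0 [seq sf_expz i0 (SfVar i) (a i) | i <- index_enum 'I_n]).
    by rewrite sf_evalF_prod // big_map; apply: eq_bigr => i _; rewrite sf_evalF_expz.
  elim: m => // -[_ _|m IH _]; first by exists e; rewrite mulr1n.
  have [//|f fE] := IH; exists (SfAdd e f).
  by rewrite mulrS fE eE.
elim: s s0 sP => // -[a m] [_ _|t s IH _] /=.
  by rewrite andbT big_seq1; exact: H.
move=> /andP[m0 sP]; have [//|f fE] := IH isT.
have [e eE] := H a _ m0.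
by exists (SfAdd e f); rewrite big_cons fE eE.
Qed.

Lemma positive_functions_sf (x : atlas X) F :
  positive_functions (X := X) F -> exists e, F = sf_evalF (val x) e.
Proof.
case=> [y [P [Q [yX]]]].
rewrite -[y]/(val (exist _ y (mem_set yX) : atlas X)) => /positive_laurent_sf[e ->].
move=> /positive_laurent_sf[f ->] ->.
exact: (sf_evalF_chart_change x _ (SfDiv e f)).
Qed.

(** An expansion of a positive function in the basis is an equality of two
subtraction-free expressions, so it can be evaluated in every semifield; one
expansion serves the positive and the tropical points simultaneously. *)
Lemma value_basis_expansion (B : set (ratfun X)) (x : atlas X) (e : sf_expr n) :
  multiplicative_basis B ->
  exists (s : seq B) (m : B -> int),
    forall (T : choiceType) (S : semifield T) (V : zmodType) (phi : T -> V),
      log_like S phi -> forall p : 'rV[T]_n,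
      phi (sf_eval S (p 0) e) =
      \sum_(b <- s) phi (value (val b) (point_of S x p)) *~ m b.
Proof.
case=> Bpos Bgen _.
have [s [m [sB FE]]] := Bgen _ (sf_evalF_positive x e).
have {s sB FE} [s FE] : exists s : seq B, sf_evalF (val x) e =
    \prod_(b <- s) val b ^ m (val b).
  suff [t st] : exists t : seq B, s = map val t by exists t; rewrite FE st big_map.
  elim: s sB {FE} => [|b s IH] sB; first by exists [::].
  have [|t ->] := IH; first by move=> c cs; apply: sB; rewrite /= in_cons (cs : c \in s) orbT.
  have bB : B b by apply: sB; rewrite /= mem_head.
  by exists ((exist _ b (mem_set bB) : B) :: t).
exists s, (fun b => m (val b)) => T S V phi phiM p.
have /choice[f fE] (b : B) : exists e, val b = sf_evalF (val x) e.
  by apply: positive_functions_sf; apply: Bpos; exact: set_valP.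
have eE : sf_evalF (val x) e =
    sf_evalF (val x) (sf_prod i0 [seq sf_expz i0 (f b) (m (val b)) | b <- s]).
  rewrite FE sf_evalF_prod ?chart_neq0 // big_map; apply: eq_bigr => b _.
  by rewrite sf_evalF_expz ?chart_neq0 // -fE.
rewrite (sf_eval_unique k0 (chart_coordinates x) S (p 0) eE).
rewrite (log_like_prod _ phiM) big_map; apply: eq_bigr => b _.
by rewrite (log_like_expz _ phiM) (value_point_of S p (fE b)).
Qed.

End PositiveFunctions.

End Charts.

(** * Topological preliminaries *)

Lemma cvg_initial (S : choiceType) (T : topologicalType) (f : S -> T)
    (F : set_system (initial_topology f)) {FF : Filter F} (s : initial_topology f) :
  f @ F --> f s -> F --> s.
Proof.
move=> cvf A [B [[D oD <-] Ds] BA]; apply: filterS BA _.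
by apply: cvf; exact: open_nbhs_nbhs.
Qed.

Lemma continuous_initial (Z : topologicalType) (S : choiceType) (T : topologicalType)
    (f : S -> T) (g : Z -> initial_topology f) z :
  {for z, continuous (f \o g)} -> {for z, continuous g}.
Proof. by move=> fg; apply: cvg_initial. Qed.

Lemma cvg_pointwise (I : Type) (T : topologicalType)
    (F : set_system {ptws I -> T}) {FF : Filter F} (f : {ptws I -> T}) :
  (forall i, (fun g : {ptws I -> T} => g i) @ F --> f i) -> F --> f.
Proof. by move=> cvF; apply/cvg_sup => i; apply: cvg_initial; exact: cvF. Qed.

Lemma eval_continuous (I : Type) (T : topologicalType) (i : I) :
  continuous (fun g : {ptws I -> T} => g i).
Proof.
move=> f A fA; have /cvg_sup/(_ i) fi : nbhs f --> (f : {ptws I -> T}) by exact: cvg_id.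
by apply: fi; exact: (@initial_continuous _ _ (fun g : {ptws I -> T} => g i)).
Qed.

Lemma continuous_rV (T : topologicalType) (U : topologicalType) n (f : T -> 'rV[U]_n) x :
  (forall i, {for x, continuous (fun t => f t 0 i)}) -> {for x, continuous f}.
Proof.
move=> fc A [P fP PA]; rewrite nbhs_simpl /=.
have : \forall t \near x, forall i, P 0 i (f t 0 i).
  by apply: filter_forall => i; exact: (fc i _ (fP 0 i)).
by apply: filterS => t Pt; apply: PA => j i; rewrite ord1.
Qed.

(** The form in which relations are passed to the limit: continuity is only
needed at the limit point. *)
Lemma closure_ge0 (T : topologicalType) (R : realType) (C : set T) (f : T -> R) x :
  closure C x -> {for x, continuous f} -> (forall t, C t -> 0 <= f t) -> 0 <= f x.
Proof.
move=> Cx fx f0; rewrite leNgt; apply/negP => fx0.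
have : nbhs (f x) [set y | y < 0] by exact: lt_nbhsl.
by move=> /fx /Cx [t [/f0 ft0 /=]]; rewrite ltNge ft0.
Qed.

Lemma closure_eq (T : topologicalType) (R : realType) (C : set T) (f g : T -> R) x :
  closure C x -> {for x, continuous f} -> {for x, continuous g} ->
  (forall t, C t -> f t = g t) -> f x = g x.
Proof.
move=> Cx fx gx fg; apply/eqP.
rewrite eq_le -[f x <= _]subr_ge0 -[g x <= _]subr_ge0; apply/andP; split.
  apply: (closure_ge0 (f := g \- f) Cx); first exact: cvgB.
  by move=> t /fg; rewrite /= => ->; rewrite subrr.
apply: (closure_ge0 (f := f \- g) Cx); first exact: cvgB.
by move=> t /fg; rewrite /= => ->; rewrite subrr.
Qed.

(** Lets the limit lemmas apply to the neighbourhood filters of this space. *)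
#[local] Instance nonzero_vectors_filter (R : realType) (I : Type)
  (v : nonzero_vectors R I) : ProperFilter (nbhs v) := nbhs_pfilter v.

Section NonzeroVectors.
Variables (R : realType) (I : Type).
Local Notation V := (nonzero_vectors R I).

Lemma cvg_nonzero_vectors (F : set_system V) {FF : Filter F} (v : V) :
  (forall i, (fun u : V => val u i) @ F --> val v i) -> F --> v.
Proof. by move=> cvF; apply: cvg_initial; apply: cvg_pointwise. Qed.

Lemma continuous_nonzero_vectors (T : topologicalType) (f : T -> V) x :
  (forall i, {for x, continuous (fun t => val (f t) i)}) -> {for x, continuous f}.
Proof. by move=> fc; apply: cvg_nonzero_vectors. Qed.

Lemma coordinate_continuous i : continuous (fun u : V => val u i).
Proof.
move=> u; apply: (continuous_comp (g := fun g : {ptws I -> R} => g i)).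
  exact: initial_continuous.
exact: eval_continuous.
Qed.

Lemma scale_vector_subproof (c : R) (v : V) : c != 0 ->
  (fun i => c * val v i) \in [set v : {ptws I -> R} | exists i, v i != 0].
Proof.
move=> c0; apply/mem_set; have [i vi] := set_valP v.
by exists i; rewrite mulf_neq0.
Qed.

Definition scale_vector (c : R) (c0 : c != 0) (v : V) : V :=
  SigSub (scale_vector_subproof v c0).

Lemma scale_vector_continuous c (c0 : c != 0) : continuous (scale_vector c0).
Proof.
move=> v; apply: continuous_nonzero_vectors => i.
exact: (cvgM (cvg_cst c) (@coordinate_continuous i v)).
Qed.

Lemma projective_eq (v w : V) :
  \pi_(projective_space R I) v = \pi w <->
  exists2 c : R, c != 0 & forall i, val w i = c * val v i.
Proof. by split=> [/eqmodP/asboolP|?] //; apply/eqmodP/asboolP. Qed.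

(** The saturation of an open set is the union of its images under the
nonzero homotheties, which are homeomorphisms. *)
Lemma projective_pi_open (A : set V) :
  open A -> open (\pi_(projective_space R I) @` A).
Proof.
move=> oA; rewrite /open /= /quotient_open.
have -> : \pi_(projective_space R I) @^-1` (\pi_(projective_space R I) @` A) =
    \bigcup_(c : {c : R | c != 0}) (scale_vector (proj2_sig c) @^-1` A).
  apply/seteqP; split=> [v /= [w Aw /esym/projective_eq[c c0 wE]]|v [c _ /= Av]].
    have E : w = scale_vector c0 v.
      by apply: val_inj; apply/funext => i; rewrite wE.
    by exists (exist _ c c0) => //; move: Aw; rewrite E.
  exists (scale_vector (proj2_sig c) v) => //; apply/esym/projective_eq.
  by exists (val c) => //; exact: (proj2_sig c).
apply: bigcup_open => c _; apply: open_comp => // v _.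
exact: scale_vector_continuous.
Qed.

End NonzeroVectors.

(** * Comparison of logarithms with the tropical semifield *)

Section LogAndTropical.
Variables (R : realType) (n : nat).
Local Notation Rp := (positive_reals R).
Local Notation Rt := (tropical_reals R).

Definition log_eval (p : 'I_n -> {posnum R}) (e : sf_expr n) : R :=
  ln (sf_eval Rp p e)%:num.

Definition exp_point (q : 'rV[R]_n) : 'rV[{posnum R}]_n :=
  map_mx (fun t => PosNum (expR_gt0 t)) q.

Lemma expR_log_eval p e : expR (log_eval p e) = (sf_eval Rp p e)%:num.
Proof. by rewrite lnK // posrE. Qed.

Lemma ln_positive_log_like : log_like Rp (fun a : {posnum R} => ln a%:num).
Proof. by move=> a b; rewrite /= lnM // posrE. Qed.

Lemma id_tropical_log_like : log_like Rt (@id R).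
Proof. by []. Qed.

Lemma log_evalM p a b :
  log_eval p (SfMul a b) = log_eval p a + log_eval p b.
Proof. exact: ln_positive_log_like. Qed.

Lemma log_eval_div p a b :
  log_eval p (SfDiv a b) = log_eval p a - log_eval p b.
Proof. exact: (log_like_div ln_positive_log_like). Qed.

Lemma tropicalD (q : 'I_n -> R) a b :
  sf_eval Rt q (SfAdd a b) = Num.max (sf_eval Rt q a) (sf_eval Rt q b) :> R.
Proof. by []. Qed.

Lemma tropicalM (q : 'I_n -> R) a b :
  sf_eval Rt q (SfMul a b) = sf_eval Rt q a + sf_eval Rt q b :> R.
Proof. by []. Qed.

Lemma tropical_div (q : 'I_n -> R) a b :
  sf_eval Rt q (SfDiv a b) = sf_eval Rt q a - sf_eval Rt q b :> R.
Proof. by []. Qed.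

(** For x <= y, one has y <= x + y <= 2 y. *)
Lemma ln_add_max (x y : R) : 0 < x -> 0 < y ->
  `|ln (x + y) - Num.max (ln x) (ln y)| <= ln 2.
Proof.
wlog xy : x y / x <= y => [W x0 y0|x0 y0].
  by case: (leP x y) => [|/ltW] le; [exact: W|rewrite [x + y]addrC maxC; exact: W].
have le : ln x <= ln y by rewrite ler_ln ?posrE.
rewrite (max_idPr le) ger0_norm; last first.
  by rewrite subr_ge0 ler_ln ?posrE ?addr_gt0 // lerDr ltW.
rewrite lerBlDr -lnM ?posrE // ler_ln ?posrE ?addr_gt0 ?mulr_gt0 //.
by rewrite mulrDl mul1r lerD2r.
Qed.

Lemma log_evalD p a b :
  `|log_eval p (SfAdd a b) - Num.max (log_eval p a) (log_eval p b)| <= ln 2.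
Proof. exact: ln_add_max. Qed.

Lemma ln2_gt0 : 0 < ln 2 :> R. Proof. by rewrite ln_gt0 // ltr1n. Qed.

(** The error made in replacing + by max is at most log 2 at each addition, so the
total error depends on the expression but not on the point. *)
Lemma log_eval_tropical_close e :
  exists K : R, forall q : 'rV[R]_n,
    `|log_eval (exp_point q 0) e - sf_eval Rt (q 0) e| <= K.
Proof.
elim: e => [i|a [K aK] b [L bL]|a [K aK] b [L bL]|a [K aK] b [L bL]].
- by exists 0 => q; rewrite /log_eval /sf_eval /= mxE /= expRK subrr normr0.
- exists (ln 2 + Num.max K L) => q.
  rewrite -(subrKA (Num.max (log_eval (exp_point q 0) a) (log_eval (exp_point q 0) b))).
  apply: (le_trans (ler_normD _ _)); apply: lerD; first exact: log_evalD.
  have := aK q; have := bL q; rewrite tropicalD.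
  move: (log_eval _ _) (log_eval _ _) (sf_eval _ _ _) (sf_eval _ _ _) => x y z t.
  rewrite !ler_norml => /andP[? ?] /andP[? ?].
  have : K <= Num.max K L by rewrite le_max lexx.
  have : L <= Num.max K L by rewrite le_max lexx orbT.
  move: (Num.max K L) => M ? ?.
  by apply/andP; split; case: (leP x y) => ?; case: (leP z t) => ?; lra.
- exists (K + L) => q; rewrite log_evalM tropicalM.
  by rewrite opprD addrACA (le_trans (ler_normD _ _)) // lerD.
- exists (K + L) => q; rewrite log_eval_div tropical_div.
  by rewrite opprD addrACA -opprD (le_trans (ler_normB _ _)) // lerD.
Qed.

Variable i0 : 'I_n.

(** The function 2 + sum_i (X_i + 1 / X_i).  Its logarithm dominates log 2 and all
the |log X_i|, and its tropicalization dominates all the |q_i|. *)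
Definition sf_gauge : sf_expr n :=
  foldr (fun i => SfAdd (SfAdd (SfVar i) (SfDiv (sf_one i0) (SfVar i))))
    (sf_two i0) (enum 'I_n).

Lemma sf_eval_one T (S : semifield T) (p : 'I_n -> T) : sf_eval S p (sf_one i0) = sone S.
Proof. by rewrite /sf_eval /= /sdiv smulC smulV. Qed.

Lemma log_eval_two p : log_eval p (sf_two i0) = ln 2.
Proof.
rewrite /log_eval.
rewrite -[sf_eval _ _ _]/(sadd Rp (sf_eval Rp p (sf_one i0)) (sf_eval Rp p (sf_one i0))).
by rewrite sf_eval_one.
Qed.

Lemma tropical_two (q : 'I_n -> R) : sf_eval Rt q (sf_two i0) = 0.
Proof.
by rewrite tropicalD sf_eval_one maxxx.
Qed.

Lemma log_eval_gauge_two p : ln 2 <= log_eval p sf_gauge.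
Proof.
rewrite -(log_eval_two p) ler_ln ?posrE // /sf_gauge.
elim: (enum _) => //= i s IH; apply: (le_trans IH).
by rewrite lerDr.
Qed.

Lemma log_eval_gauge_ge0 p : 0 <= log_eval p sf_gauge.
Proof. exact: le_trans (ltW ln2_gt0) (log_eval_gauge_two p). Qed.

Lemma log_eval_gauge_var p i : `|ln (p i)%:num| <= log_eval p sf_gauge.
Proof.
have [le1 le2] : (p i)%:num <= (sf_eval Rp p sf_gauge)%:num /\
    (p i)%:num^-1 <= (sf_eval Rp p sf_gauge)%:num.
  rewrite /sf_gauge; have : i \in enum 'I_n by rewrite mem_enum.
  elim: (enum _) => //= j s IH; rewrite inE => /orP[/eqP<-|/IH[le1 le2]]; last first.
    by split; [apply: (le_trans le1)|apply: (le_trans le2)]; rewrite lerDr.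
  split; rewrite -/(sf_eval Rp p _).
    by rewrite -addrA lerDl.
  by rewrite divff // mul1r [X in X + _]addrC -addrA lerDl.
rewrite ler_norml lerNl -lnV ?posrE // !ler_ln ?posrE ?invr_gt0 //.
by rewrite le1 le2.
Qed.

(** The logarithm of a sum exceeds the larger logarithm by at most log 2, which
is itself at most the logarithm of the gauge. *)
Lemma log_eval_gauge_bound e : exists K : R, forall p,
  `|log_eval p e| <= K * log_eval p sf_gauge.
Proof.
elim: e => [i|a [K aK] b [L bL]|a [K aK] b [L bL]|a [K aK] b [L bL]].
- by exists 1 => p; rewrite mul1r; exact: log_eval_gauge_var.
- exists (K + L + 1) => p; have := log_evalD p a b.
  have := aK p; have := bL p; have := log_eval_gauge_two p.
  move: (log_eval p (SfAdd a b)) (log_eval p sf_gauge) => x y y2.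
  rewrite !mulrDl mul1r => /le_trans La /le_trans Lb.
  have La' := normr_ge0 (log_eval p a); have Lb' := normr_ge0 (log_eval p b).
  move: La Lb La' Lb'.
  move: (log_eval p a) (log_eval p b) => u v.
  move=> La Lb.
  have := La _ (lexx _); have := Lb _ (lexx _).
  rewrite !ler_norml; move: (K * y) (L * y) => k l.
  by case: (leP u v) => ?; lra.
- exists (K + L) => p; rewrite log_evalM mulrDl.
  by rewrite (le_trans (ler_normD _ _)) // lerD.
- exists (K + L) => p; rewrite log_eval_div mulrDl.
  by rewrite (le_trans (ler_normB _ _)) // lerD.
Qed.

Lemma tropical_gauge_gt0 (q : 'rV[R]_n) : q != 0 -> 0 < sf_eval Rt (q 0) sf_gauge.
Proof.
move=> /rV0Pn[i qi].
suff H : `|q 0 i| <= sf_eval Rt (q 0) sf_gauge by apply: lt_le_trans H; rewrite normr_gt0.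
rewrite /sf_gauge; have : i \in enum 'I_n by rewrite mem_enum.
elim: (enum _) => //= j s IH; rewrite inE.
rewrite !tropicalD tropical_div sf_eval_one.
move=> /orP[/eqP<-|/IH le]; last by rewrite le_max le orbT.
by rewrite le_max ler_norml lerNl !le_max sub0r !lexx !orbT.
Qed.

Lemma tropical_zero_eval (q : 'I_n -> R) e : (forall i, q i = 0) -> sf_eval Rt q e = 0.
Proof.
rewrite /sf_eval => q0; elim: e => [i|a IHa b IHb|a IHa b IHb|a IHa b IHb] //=.
- by rewrite IHa IHb maxxx.
- by rewrite IHa IHb addr0.
- by rewrite IHa IHb /sdiv /= subrr.
Qed.

Lemma tropical_eval_continuous e : continuous (fun q : 'rV[R]_n => sf_eval Rt (q 0) e).
Proof.
elim: e => [i|a IHa b IHb|a IHa b IHb|a IHa b IHb] q.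
- exact: coord_continuous.
- exact: (@continuous_max R _ (fun q : 'rV[R]_n => sf_eval Rt (q 0) a)
    (fun q : 'rV[R]_n => sf_eval Rt (q 0) b) q (IHa q) (IHb q)).
- exact: cvgD (IHa q) (IHb q).
- exact: cvgB (IHa q) (IHb q).
Qed.

End LogAndTropical.

(** * The closure of the cone of logarithms *)

Section Compactification.
Variables (k : fieldType) (n : nat) (X : positive_space k n) (R : realType).
Variables (B : set (ratfun X)) (i0 : 'I_n) (x0 : atlas X).
Hypotheses (k0 : [pchar k] =i pred0) (HB : multiplicative_basis B).
Local Notation Rp := (positive_reals R).
Local Notation Rt := (tropical_reals R).
Local Notation V := (nonzero_vectors R B).
Local Notation P := (projective_space R B).
Local Notation logs p := (@log_coordinates k n X R B (point_of Rp x0 p)).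
Local Notation trops q := (@tropical_coordinates k n X R B (tropical_point_of x0 q)).
Local Notation two := (sf_two i0).
Local Notation gauge := (sf_gauge i0).

(** The exponents of the function [e] in the basis [B]; the default value is never
taken when [B] is a basis. *)
Definition expansion (e : sf_expr n) : seq B * (B -> int) :=
  xget ([::], fun=> 0) [set sm | forall (T : choiceType) (S : semifield T)
    (phi : T -> R), log_like S phi -> forall p : 'rV[T]_n,
      phi (sf_eval S (p 0) e) =
      \sum_(b <- sm.1) phi (value (val b) (point_of S x0 p)) *~ sm.2 b].

(** The value at [e] of the additive character of the positive functions that
extends the vector [u]. *)
Definition basis_form (e : sf_expr n) (u : B -> R) : R :=
  \sum_(b <- (expansion e).1) u b *~ (expansion e).2 b.

Lemma basis_form_value e (T : choiceType) (S : semifield T) (phi : T -> R) :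
  log_like S phi -> forall p : 'rV[T]_n,
  basis_form e (fun b => phi (value (val b) (point_of S x0 p))) = phi (sf_eval S (p 0) e).
Proof.
move=> phiM p; rewrite /basis_form /expansion; case: xgetP => [sm _ smP|no].
  by rewrite (smP _ _ _ phiM).
have [s [m smP]] := value_basis_expansion k0 i0 x0 e HB.
by case: (no (s, m)) => U W psi psiM q /=; exact: smP.
Qed.

Lemma basis_form_log e p : basis_form e (logs p) = log_eval (p 0) e.
Proof. exact: (basis_form_value e (@ln_positive_log_like R)). Qed.

Lemma basis_form_tropical e q : basis_form e (trops q) = sf_eval Rt (q 0) e.
Proof. exact: (basis_form_value e (@id_tropical_log_like R)). Qed.

Lemma basis_formZ e c u : basis_form e (fun b => c * u b) = c * basis_form e u.
Proof. by rewrite /basis_form mulr_sumr; apply: eq_bigr => b _; rewrite mulrzAr. Qed.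

Lemma basis_form_continuous e : continuous (fun u : V => basis_form e (val u)).
Proof.
rewrite /basis_form; elim: (expansion e).1 => [|b s IH] u.
  rewrite (_ : (fun u : V => _) = cst 0); first exact: cvg_cst.
  by apply/funext => w; rewrite big_nil.
rewrite (_ : (fun u : V => _) = (fun w : V => val w b * ((expansion e).2 b)%:~R) \+
    (fun w : V => \sum_(c <- s) val w c *~ (expansion e).2 c)); last first.
  by apply/funext => w; rewrite big_cons /= mulrzr.
apply: cvgD; last exact: IH.
by apply: cvgM; [exact: coordinate_continuous|exact: cvg_cst].
Qed.

Lemma basis_form0 e u : (forall b, u b = 0) -> basis_form e u = 0.
Proof. by move=> u0; rewrite /basis_form big1 // => b _; rewrite u0 mul0rz. Qed.

Lemma basis_expr (b : B) : exists e, val b = sf_evalF (val x0) e.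
Proof.
by case: HB => Bpos _ _; apply: positive_functions_sf => //; apply: Bpos; exact: set_valP.
Qed.

Lemma logs_expr b e p : val b = sf_evalF (val x0) e -> logs p b = log_eval (p 0) e.
Proof. by move=> bE; rewrite /log_coordinates (value_point_of k0 Rp p bE). Qed.

Lemma trops_expr b e q : val b = sf_evalF (val x0) e -> trops q b = sf_eval Rt (q 0) e.
Proof.
by move=> bE; rewrite /tropical_coordinates /tropical_point_of (value_point_of k0 Rt q bE).
Qed.

(** The cone over the positive part, as [log_coneP] shows. *)
Definition log_cone : set V := [set u | exists (c : R) (p : 'rV[{posnum R}]_n),
  c != 0 /\ forall b, val u b = c * logs p b].

Lemma log_cone_form (u : V) c p e :
  (forall b, val u b = c * logs p b) -> basis_form e (val u) = c * log_eval (p 0) e.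
Proof.
move=> uE; rewrite -basis_form_log -basis_formZ; congr (basis_form e _).
exact/funext.
Qed.

Lemma log_coneP (u : V) : positive_part (X := X) R B (\pi_P u) <-> log_cone u.
Proof.
split=> [[a [w wE /esym/projective_eq[c c0 uE]]]|[c [p [c0 uE]]]].
  have [p ap] := point_in_chart x0 a; exists c, p; split=> // b.
  by rewrite -ap -wE uE.
exists (point_of Rp x0 p); have c0' : c^-1 != 0 by rewrite invr_eq0.
exists (scale_vector c0' u); last by apply/projective_eq; exists c^-1.
by apply/funext => b /=; rewrite uE mulKf.
Qed.

(** The projection is continuous and open and the cone is saturated. *)
Lemma closure_positive_part (u : V) :
  closure (positive_part (X := X) R B) (\pi_P u) <-> closure log_cone u.
Proof.
split=> [cu A|cu A /pi_continuous /cu[w [/log_coneP wC Aw]]]; last by exists (\pi_P w).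
rewrite nbhsE => -[U [oU Uu] UA].
have /cu[Q [QX [w Uw wQ]]] : nbhs (\pi_P u) (\pi_P @` U).
  by apply: open_nbhs_nbhs; split; [exact: projective_pi_open|exists u].
by exists w; split; [apply/log_coneP; rewrite wQ|exact: UA].
Qed.

Section ClosurePoint.
Variable v : V.
Hypothesis vC : closure log_cone v.
Local Notation form e u := (basis_form e (val (u : V))).

Lemma closure_formM a b : form (SfMul a b) v = form a v + form b v.
Proof.
apply: (closure_eq (f := fun u : V => form (SfMul a b) u)
  (g := fun u : V => form a u + form b u) vC).
- exact: basis_form_continuous.
- by apply: cvgD; exact: basis_form_continuous.
- by move=> u [c [p [_ /log_cone_form H]]]; rewrite !H log_evalM mulrDr.
Qed.

Lemma closure_form_div a b : form (SfDiv a b) v = form a v - form b v.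
Proof.
apply: (closure_eq (f := fun u : V => form (SfDiv a b) u)
  (g := fun u : V => form a u - form b u) vC).
- exact: basis_form_continuous.
- by apply: cvgB; exact: basis_form_continuous.
- by move=> u [c [p [_ /log_cone_form H]]]; rewrite !H log_eval_div mulrBr.
Qed.

Lemma closure_form_expr b e : val b = sf_evalF (val x0) e -> val v b = form e v.
Proof.
move=> bE; apply: (closure_eq (f := fun u : V => val u b) (g := fun u : V => form e u) vC).
- exact: coordinate_continuous.
- exact: basis_form_continuous.
- by move=> u [c [p [_ uE]]]; rewrite (log_cone_form e uE) uE (logs_expr p bE).
Qed.

(** On the cone the scalar c of u = c log(x) is recovered as u(2) / log 2.  Once
v(2) <> 0 this is continuous at v, so v divided by its scalar is still the
logarithm of a homomorphism of semifields to the positive reals. *)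
Lemma closure_log_cone_two : form two v != 0 -> log_cone v.
Proof.
move=> v2; pose d (u : V) := form two u / ln 2.
have ln20 : ln 2 != 0 :> R by rewrite gt_eqF // ln2_gt0.
have d0 : d v != 0 by rewrite mulf_neq0 ?invr_eq0.
have dc : {for v, continuous d}.
  by apply: cvgM; [exact: basis_form_continuous|exact: cvg_cst].
have quotc e : {for v, continuous (fun u : V => form e u / d u)}.
  by apply: cvgM; [exact: basis_form_continuous|exact: cvgV].
have expc e : {for v, continuous (fun u : V => expR (form e u / d u))}.
  apply: (continuous_comp (quotc e)); exact: continuous_expR.
have expD a b : expR (form (SfAdd a b) v / d v) =
    expR (form a v / d v) + expR (form b v / d v).
  apply: (closure_eq (f := fun u : V => expR (form (SfAdd a b) u / d u))
    (g := fun u : V => expR (form a u / d u) + expR (form b u / d u)) vC) => //.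
    by apply: cvgD; exact: expc.
  move=> u [c [p [c0 /log_cone_form H]]].
  rewrite /d !H log_eval_two mulfK // ![c * _]mulrC !mulfK //.
  by rewrite !expR_log_eval.
(* The limit character exponentiates to evaluation at this point. *)
pose p : 'rV[{posnum R}]_n := \row_i PosNum (expR_gt0 (form (SfVar i) v / d v)).
have formE e : expR (form e v / d v) = (sf_eval Rp (p 0) e)%:num.
  elim: e => [i|a IHa b IHb|a IHa b IHb|a IHa b IHb].
  - by rewrite /sf_eval /= mxE.
  - by rewrite expD IHa IHb.
  - by rewrite closure_formM mulrDl expRD IHa IHb.
  - by rewrite closure_form_div mulrBl expRD expRN IHa IHb.
exists (d v), p; split=> // b; have [e bE] := basis_expr b.
rewrite (closure_form_expr bE) (logs_expr p bE) /log_eval -formE expRK.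
by rewrite mulrC divfK.
Qed.

Lemma closure_form_bound e :
  exists K : R, `|form e v| <= K * `|form gauge v|.
Proof.
have [K Ke] := log_eval_gauge_bound R i0 e; exists K; rewrite -subr_ge0.
apply: (closure_ge0 (f := fun u : V => K * `|form gauge u| - `|form e u|) vC).
  apply: cvgB; last by apply: cvg_norm; exact: basis_form_continuous.
  by apply: cvgM; [exact: cvg_cst|]; apply: cvg_norm; exact: basis_form_continuous.
move=> u [c [p [_ /log_cone_form H]]]; rewrite !H !normrM mulrCA -mulrBr.
by rewrite mulr_ge0 // subr_ge0 [`|log_eval _ gauge|]ger0_norm // log_eval_gauge_ge0.
Qed.

(** The bounds |log F| <= K log N are homogeneous, so they hold on the closure of
the cone: if v(N) vanished, so would v. *)
Lemma closure_gauge_neq0 : form gauge v != 0.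
Proof.
have [b vb] := set_valP v; apply: contra_neq vb => v0.
have [e /closure_form_expr ->] := basis_expr b; have [K] := closure_form_bound e.
by rewrite v0 normr0 mulr0 normr_le0 => /eqP.
Qed.

(** The factor u(N) makes this quadratic in u, hence insensitive to the sign of
the homogeneous coordinates; only a positive factor is left undetermined. *)
Definition tropical_limit (u : V) : 'rV[R]_n :=
  \row_i (form gauge u * form (SfVar i) u).

(** On the cone, u = c log(x) gives u(N) u = c^2 log(N(x)) log(x), a nonnegative
multiple of log(x) whose value at 2 bounds the defect of additivity for max; at
v this bound vanishes. *)
Lemma closure_tropical_eval e : form two v = 0 ->
  form gauge v * form e v = sf_eval Rt (tropical_limit v 0) e.
Proof.
move=> v2.
have gc e' : {for v, continuous (fun u : V => form gauge u * form e' u)}.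
  by apply: cvgM; exact: basis_form_continuous.
have maxE a b : form gauge v * form (SfAdd a b) v =
    Num.max (form gauge v * form a v) (form gauge v * form b v).
  apply/eqP; rewrite -subr_eq0 -normr_le0 -oppr_ge0.
  rewrite -[- `|_|]add0r -[X in X - _](mulr0 (form gauge v)) -[X in _ * X]v2.
  apply: (closure_ge0 (f := fun u : V => form gauge u * form two u -
     `|form gauge u * form (SfAdd a b) u -
      Num.max (form gauge u * form a u) (form gauge u * form b u)|) vC).
    apply: cvgB; first exact: gc.
    apply: cvg_norm; apply: cvgB; first exact: gc.
    exact: (@continuous_max R _ (fun u : V => form gauge u * form a u)
     (fun u : V => form gauge u * form b u) v (gc a) (gc b)).
  move=> u [c [p [_ /log_cone_form H]]]; rewrite !H log_eval_two.
  rewrite ![c * log_eval _ gauge * _]mulrACA.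
  have L0 : 0 <= c * c * log_eval (p 0) gauge.
    by rewrite mulr_ge0 ?log_eval_gauge_ge0 // -expr2 sqr_ge0.
  rewrite !mulrA -maxr_pMr // -mulrBr normrM (ger0_norm L0) -mulrBr mulr_ge0 //.
  by rewrite subr_ge0 log_evalD.
elim: e => [i|a IHa b IHb|a IHa b IHb|a IHa b IHb].
- by rewrite /sf_eval /= mxE.
- by rewrite maxE IHa IHb.
- by rewrite closure_formM mulrDr IHa IHb.
- by rewrite closure_form_div mulrBr IHa IHb.
Qed.

End ClosurePoint.

Lemma boundary_tropical (v : V) :
  tropical_boundary (X := X) R B (\pi_P v) ->
  [/\ basis_form gauge (val v) != 0, tropical_limit v != 0 &
      forall b, trops (tropical_limit v) b = basis_form gauge (val v) * val v b].
Proof.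
move=> [/closure_positive_part vC /log_coneP vN].
have v2 : basis_form two (val v) = 0.
  by apply/eqP; apply: contra_notT vN; exact: closure_log_cone_two.
have N0 := closure_gauge_neq0 vC; split=> // [|b].
  have := closure_tropical_eval vC gauge v2.
  apply: contra_eqN => /eqP q0; rewrite q0 tropical_zero_eval ?mulf_neq0 //.
  by move=> i; rewrite mxE.
have [e bE] := basis_expr b.
by rewrite (trops_expr _ bE) (closure_form_expr vC bE) closure_tropical_eval.
Qed.

Lemma tropical_vector_subproof (q : 'rV[R]_n) : q != 0 ->
  trops q \in [set v : {ptws B -> R} | exists i, v i != 0].
Proof.
move=> q0; apply/mem_set; apply: contrapT => /forallNP no.
have /rV0Pn[i qi] := q0; case/negP: qi; apply/eqP.
rewrite -[LHS]/(sf_eval Rt (q 0) (SfVar i)) -basis_form_tropical; apply: basis_form0 => b.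
by apply/eqP; apply: contrapT => /negP; exact: no.
Qed.

Definition tropical_vector q (q0 : q != 0) : V := SigSub (tropical_vector_subproof q0).

Lemma log_vector_subproof (c : R) (p : 'rV[{posnum R}]_n) : c != 0 ->
  (fun b => c * logs p b) \in [set v : {ptws B -> R} | exists i, v i != 0].
Proof.
move=> c0; apply/mem_set; apply: contrapT => /forallNP no.
have : c * log_eval (p 0) two != 0.
  by rewrite log_eval_two mulf_neq0 // gt_eqF // ln2_gt0.
rewrite -basis_form_log -basis_formZ basis_form0 ?eqxx // => b.
by apply/eqP; apply: contrapT => /negP; exact: no.
Qed.

Definition log_vector c (c0 : c != 0) p : V := SigSub (log_vector_subproof p c0).

(** The vector of q is the limit of log(exp(m q)) / m as m tends to infinity, by
[log_eval_tropical_close] and the homogeneity of tropical evaluation.  It has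
coordinate 0 at the function 2, unlike the points of the cone. *)
Lemma tropical_boundaryP q (q0 : q != 0) :
  tropical_boundary (X := X) R B (\pi_P (tropical_vector q0)).
Proof.
split; last first.
  move=> /log_coneP[c [p [c0 /log_cone_form H]]]; move: (H two).
  rewrite basis_form_tropical tropical_two log_eval_two => /esym/eqP.
  by rewrite mulf_eq0 (negbTE c0) gt_eqF // ln2_gt0.
apply/closure_positive_part => A.
have cn m : m.+1%:R^-1 != 0 :> R by rewrite invr_eq0 pnatr_eq0.
pose u m : V := log_vector (cn m) (exp_point (m.+1%:R *: q)).
have cvg_eval e : (fun m => m.+1%:R^-1 * log_eval (exp_point (m.+1%:R *: q) 0) e) @ \oo -->
    sf_eval Rt (q 0) e.
  have [K Ke] := log_eval_tropical_close R e.
  apply/cvgrPdist_le => eps eps0; near=> m.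
  have -> : sf_eval Rt (q 0) e = m.+1%:R^-1 * sf_eval Rt ((m.+1%:R *: q) 0) e.
    by rewrite sf_eval_scale // mulKf ?pnatr_eq0.
  rewrite -mulrBr normrM ger0_norm // distrC.
  rewrite (le_trans (ler_wpM2l _ (Ke _))) // ler_pdivrMl //.
  have lem : K / eps <= m%:R by near: m; exact: nbhs_infty_ger.
  by rewrite -ler_pdivrMr // (le_trans lem) // ler_nat.
have cvgu : u @ \oo --> tropical_vector q0.
  apply: cvg_nonzero_vectors => b; have [e bE] := basis_expr b.
  have := cvg_eval e; rewrite -(trops_expr q bE).
  rewrite [X in X @ _](_ : _ = fun m => val (u m) b) //.
  by apply/funext => m; rewrite -(logs_expr _ bE).
move=> /cvgu [m _ /(_ m (leqnn _)) Am]; exists (u m); split=> //.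
by exists m.+1%:R^-1, (exp_point (m.+1%:R *: q)).
Unshelve. all: by end_near.
Qed.


(** * The homeomorphism of the spherical space with the boundary *)

Local Notation S := (spherical_space X R).
Local Notation T := (nonzero_tropical_points X R).
Local Notation boundary := (tropical_boundary (X := X) R B).

Lemma nonzero_tropical_chart (a : T) :
  exists2 q : 'rV[R]_n, q != 0 & val a = tropical_point_of x0 q.
Proof.
have [q aq] := point_in_chart x0 (val a); exists q => //.
apply: contra_notN (set_valP a) => /eqP q0.
by exists x0; rewrite -q0; exact: aq.
Qed.

(** The vanishing of all coordinates does not depend on the chart, because all
tropical values at the origin are 0. *)
Lemma chart_point_subproof (q : 'rV[R]_n) : q != 0 ->
  tropical_point_of x0 q \in ~` @tropical_zero k n X R.
Proof.
move=> /rV0Pn[i qi]; apply/mem_set => -[y /(point_of_same_values k0) same].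
have [f xE] := sf_evalF_chart_change y x0 (SfVar i).
case/negP: qi; apply/eqP; rewrite [LHS](same _ _ xE).
by apply: tropical_zero_eval => j; rewrite mxE.
Qed.

Definition chart_point q (q0 : q != 0) : T := SigSub (chart_point_subproof q0).

Lemma tropical_coordinates_neq0 (a : T) :
  (tropical_coordinates (val a) : {ptws B -> R}) \in
    [set v : {ptws B -> R} | exists i, v i != 0].
Proof. by have [q q0 ->] := nonzero_tropical_chart a; exact: tropical_vector_subproof. Qed.

Definition coordinate_vector (a : T) : V := SigSub (tropical_coordinates_neq0 a).

Lemma coordinate_vector_boundary a : \pi_P (coordinate_vector a) \in boundary.
Proof.
apply/mem_set; have [q q0 aq] := nonzero_tropical_chart a.
suff -> : coordinate_vector a = tropical_vector q0 by exact: tropical_boundaryP.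
by apply: val_inj; rewrite /= aq.
Qed.

Definition eta_point (a : T) : boundary := SigSub (coordinate_vector_boundary a).

Definition eta : S -> boundary := eta_point \o repr.

Lemma trops_scale l q b : 0 < l -> trops (l *: q) b = l * trops q b.
Proof.
by move=> l0; have [e bE] := basis_expr b; rewrite !(trops_expr _ bE) sf_eval_scale.
Qed.

(** Scaling is defined by means of an arbitrary chart; here it is read in the
fixed one. *)
Lemma scaling_chart (a b : T) q :
  val a = tropical_point_of x0 q ->
  \pi_S a = \pi_S b <->
  exists2 l, 0 < l & val b = tropical_point_of x0 (l *: q).
Proof.
move=> aq; split=> [/eqmodP/asboolP[l [x [p [l0 aE bE]]]]|[l l0 bE]].
  by exists l => //; rewrite bE; apply: tropical_point_of_scale; rewrite // -aE.
by apply/eqmodP/asboolP; exists l, x0, q.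
Qed.

Lemma eta_pi a : eta (\pi_S a) = eta_point a.
Proof.
have [q q0 rq] := nonzero_tropical_chart (repr (\pi_S a)).
have [l l0 aE] : exists2 l, 0 < l & val a = tropical_point_of x0 (l *: q).
  by apply/(scaling_chart _ rq); rewrite reprK.
apply: val_inj; apply/projective_eq; exists l => [|b]; first by rewrite gt_eqF.
by rewrite /= aE rq trops_scale.
Qed.

Lemma tropical_coordinate_continuous (b : B) :
  continuous (fun a : tropical_points X R => tropical_coordinates a b).
Proof.
apply/quotient_continuous.
have chart_continuous (x : atlas X) :
    continuous (fun p : 'rV[R]_n => value (val b) (point_of Rt x p)).
  case: HB => Bpos _ _.
  have [e bE] := positive_functions_sf k0 i0 x (Bpos _ (set_valP b)).
  rewrite (_ : (fun p => _) = fun p : 'rV[R]_n => sf_eval Rt (p 0) e).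
    exact: tropical_eval_continuous.
  by apply/funext => p; exact: value_point_of.
by move=> [x p] A /(chart_continuous x p).
Qed.

Lemma eta_continuous : continuous eta.
Proof.
suff H : continuous eta_point.
  apply/quotient_continuous; suff -> : eta \o \pi_S = eta_point by [].
  by apply/funext => a; exact: eta_pi.
move=> a; apply: continuous_initial.
suff : {for a, continuous (\pi_P \o coordinate_vector)} by [].
apply: continuous_comp; last exact: pi_continuous.
apply: continuous_nonzero_vectors => b.
apply: (@continuous_comp T (tropical_points X R) R val
  (fun z => tropical_coordinates z b)); first exact: initial_continuous.
exact: tropical_coordinate_continuous.
Qed.

Lemma boundary_limit_neq0 (Q : boundary) : tropical_limit (repr (val Q)) != 0.
Proof.
have : boundary (\pi_P (repr (val Q))) by rewrite reprK; exact: set_valP.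
by case/boundary_tropical.
Qed.

Definition eta_inv (Q : boundary) : S := \pi_S (chart_point (boundary_limit_neq0 Q)).

Lemma tropical_limitZ (u w : V) c :
  (forall b, val u b = c * val w b) -> tropical_limit u = c ^+ 2 *: tropical_limit w.
Proof.
move=> uw; have uwE : val u = fun b => c * val w b by exact/funext.
by apply/rowP => i; rewrite !mxE uwE !basis_formZ mulrACA -expr2.
Qed.

Lemma tropical_limit_trops (u : V) q :
  val u = trops q -> tropical_limit u = sf_eval Rt (q 0) gauge *: q.
Proof. by move=> uq; apply/rowP => i; rewrite !mxE uq !basis_form_tropical. Qed.

Lemma etaK : cancel eta eta_inv.
Proof.
move=> s; rewrite -[s]reprK eta_pi; set a := repr s.
have [q q0 aq] := nonzero_tropical_chart a.
have /projective_eq[c c0 vE] :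
  \pi_P (coordinate_vector a) = \pi_P (repr (val (eta_point a))) by rewrite reprK.
apply/esym/(scaling_chart _ aq); exists (c ^+ 2 * sf_eval Rt (q 0) gauge).
  by rewrite mulr_gt0 ?tropical_gauge_gt0 // exprn_even_gt0.
rewrite /= (tropical_limitZ vE) (@tropical_limit_trops _ q) ?scalerA //.
by rewrite /= aq.
Qed.

Lemma eta_invK : cancel eta_inv eta.
Proof.
move=> Q; rewrite /eta_inv eta_pi; apply: val_inj.
have bQ : boundary (\pi_P (repr (val Q))) by rewrite reprK; exact: set_valP.
have [h0 _ vE] := boundary_tropical bQ.
rewrite -[RHS]reprK; apply/esym/projective_eq.
by exists (basis_form gauge (val (repr (val Q)))).
Qed.

(** The set is described through the nonzero points of the fixed chart, an open
set that the gauge cuts out by its positive tropical values. *)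
Lemma open_ray_preimage (O : set S) : open O ->
  open [set q : 'rV[R]_n | exists q0 : q != 0, O (\pi_S (chart_point q0))].
Proof.
move=> [D oD DO].
have -> : [set q : 'rV[R]_n | exists q0 : q != 0, O (\pi_S (chart_point q0))] =
    [set q : 'rV[R]_n | 0 < sf_eval Rt (q 0) gauge] `&` tropical_point_of x0 @^-1` D.
  have ODE q (q0 : q != 0) : O (\pi_S (chart_point q0)) = D (tropical_point_of x0 q).
    by rewrite -[LHS]/((\pi_S @^-1` O) (chart_point q0)) -DO.
  apply/seteqP; split=> q /=.
    by move=> [q0]; rewrite ODE => Dq; split=> //; exact: tropical_gauge_gt0.
  move=> [qN Dq]; have q0 : q != 0.
    apply: contraTneq qN => ->; rewrite tropical_zero_eval ?ltxx // => i.
    by rewrite mxE.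
  by exists q0; rewrite ODE.
apply: openI.
  apply: (@open_comp _ _ (fun q : 'rV[R]_n => sf_eval Rt (q 0) gauge) [set t | 0 < t]).
    by move=> q _; exact: tropical_eval_continuous.
  exact: open_gt.
apply: open_comp => // q _.
apply: (continuous_comp (f := existT (fun=> 'rV[R]_n) x0) (g := \pi_(tropical_points X R))).
  exact: existT_continuous.
exact: pi_continuous.
Qed.

Lemma tropical_limit_continuous : continuous tropical_limit.
Proof.
move=> u; apply: continuous_rV => i.
rewrite (_ : (fun t => _) = (fun t : V =>
    basis_form gauge (val t) * basis_form (SfVar i) (val t))).
  by apply: cvgM; exact: basis_form_continuous.
by apply/funext => t; rewrite mxE.
Qed.

(** The inverse is defined by representatives chosen without continuity.  It is
induced by the continuous map [tropical_limit], and open sets of vectors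
project to open sets. *)
Lemma eta_inv_continuous : continuous eta_inv.
Proof.
apply/continuousP => O oO.
pose W := tropical_limit @^-1`
  [set q : 'rV[R]_n | exists q0 : q != 0, O (\pi_S (chart_point q0))].
have oW : open W.
  apply: open_comp; last exact: open_ray_preimage.
  by move=> u _; exact: tropical_limit_continuous.
exists (\pi_P @` W); first exact: projective_pi_open.
apply/seteqP; split=> Q /=; last first.
  move=> OQ; exists (repr (val Q)); last exact: reprK.
  by exists (boundary_limit_neq0 Q).
move=> [w [w0 Ow] wQ].
have /projective_eq[c c0 vE] : \pi_P w = \pi_P (repr (val Q)) by rewrite reprK.
suff -> : eta_inv Q = \pi_S (chart_point w0) by [].
apply/esym/(@scaling_chart _ _ (tropical_limit w)) => //.
exists (c ^+ 2); first by rewrite exprn_even_gt0.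
by rewrite /= (tropical_limitZ vE).
Qed.

End Compactification.

Theorem proposition2p2 (k : fieldType) (n : nat) (X : positive_space k n)
    (R : realType) (B : set (ratfun X)) :
  [pchar k] =i pred0 -> (0 < n)%N ->
  countable B -> multiplicative_basis B ->
  exists eta : spherical_space X R -> tropical_boundary R B,
    homeomorphism eta /\
    forall a : nonzero_tropical_points X R,
      homogeneous_coordinates (val (eta (\pi_(spherical_space X R) a)))
        (tropical_coordinates (val a)).
Proof.
move=> k0 n0 _ HB; have [x xX] := atlas_nonempty X.
pose i0 := Ordinal n0; pose x0 : atlas X := exist _ x (mem_set xX).
exists (eta i0 x0 k0 HB); split.
  split; first exact: eta_continuous.
  exists (eta_inv i0 x0 k0 HB); split.
  - exact: eta_inv_continuous.
  - exact: etaK.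
  - exact: eta_invK.
move=> a; exists (coordinate_vector i0 x0 k0 HB a) => //.
by rewrite eta_pi.
Qed.
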